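(* Let $\mu_s=(a_s,b_s,c_s,d_s,e_s)$ with $a_s,b_s,c_s,d_s,e_s\in\mathbb R$, $b_s\neq 0$, $s=1,2$. Let $f\in L^2(\mathbb R^2,\mathbb H)$ and $\mathbf k=(k_1,k_2)\in\mathbb R^2$. Then, writing $f(\cdot-\mathbf k)$ for the function $\mathbf x\mapsto f(\mathbf x-\mathbf k)$, for almost every $\mathbf w=(w_1,w_2)\in\mathbb R^2$, $$\mathbb Q^{\mathbb H}_{\mu_1,\mu_2}[f(\cdot-\mathbf k)](\mathbf w)=e^{-i\theta_1}\;\mathbb Q^{\mathbb H}_{\mu_1,\mu_2}[f]\left(w_1+\frac{2a_1k_1}{b_1},\,w_2+\frac{2a_2k_2}{b_2}\right)\;e^{-j\theta_2},$$ where for $s=1,2$ $$\theta_s=a_sk_s^2+d_sk_s+b_sk_sw_s-4\frac{a_s^2c_s}{b_s^2}k_s^2-4\frac{a_s}{b_s}c_sw_sk_s-2\frac{a_s}{b_s}e_sk_s .$$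
   Context: $\mathbb H$ is the real quaternion algebra with imaginary units $i,j,k$. $L^p(\mathbb R^2,\mathbb H)$ is the space of $\mathbb H$-valued functions $f$ with $|f|\in L^p(\mathbb R^2)$. Two-sided quaternion quadratic-phase Fourier transform (Q-QPFT) of $f\in L^1(\mathbb R^2,\mathbb H)$: $$\mathbb Q^{\mathbb H}_{\mu_1,\mu_2}[f](\mathbf w)=\int_{\mathbb R^2}\Lambda^i_{\mu_1}(x_1,w_1)f(\mathbf x)\Lambda^j_{\mu_2}(x_2,w_2)\,d\mathbf x,$$ where $\Lambda^i_{\mu_1}(x_1,w_1)=\sqrt{\tfrac{b_1i}{2\pi}}\,e^{-i(a_1x_1^2+b_1x_1w_1+c_1w_1^2+d_1x_1+e_1w_1)}$ and $\Lambda^j_{\mu_2}(x_2,w_2)=\sqrt{\tfrac{b_2j}{2\pi}}\,e^{-j(a_2x_2^2+b_2x_2w_2+c_2w_2^2+d_2x_2+e_2w_2)}$. The square roots are principal square roots in the complex planes $\mathbb R+\mathbb R i$ and $\mathbb R+\mathbb R j$ respectively. On $L^2(\mathbb R^2,\mathbb H)$ the Q-QPFT is the unique continuous extension to $L^2(\mathbb R^2,\mathbb H)$ of its restriction to $L^1\cap L^2$ (which is an isometry for the $L^2$ norm). *)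

(* Defs.v *)
From HB Require Import structures.
From mathcomp Require Import all_boot all_order all_algebra.
From mathcomp Require Import ring.
From mathcomp Require Export complex.
From mathcomp Require Import all_classical all_reals all_analysis.

Set Implicit Arguments.
Unset Strict Implicit.
Unset Printing Implicit Defensive.
Import Order.TTheory GRing.Theory Num.Theory.
Import numFieldNormedType.Exports.

Local Open Scope classical_set_scope.
Local Open Scope ring_scope.

(* [Quat a b c d] is a + b i + c j + d k. *)
Record quaternion (R : Type) := Quat { qre : R; qim : R; qjm : R; qkm : R }.

Section QuaternionChoice.
Variable R : choiceType.

Definition tuple_of_quat (q : quaternion R) := (qre q, qim q, qjm q, qkm q).
Definition quat_of_tuple (t : R * R * R * R) :=
  let: (a, b, c, d) := t in Quat a b c d.
Lemma tuple_of_quatK : cancel tuple_of_quat quat_of_tuple.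
Proof. by case. Qed.

HB.instance Definition _ :=
  Choice.copy (quaternion R) (can_type tuple_of_quatK).
End QuaternionChoice.

Section QuaternionRing.
Variable R : comNzRingType.
Local Notation H := (quaternion R).
Implicit Types p q r : H.

Definition quat_add p q :=
  Quat (qre p + qre q) (qim p + qim q) (qjm p + qjm q) (qkm p + qkm q).
Definition quat_opp q := Quat (- qre q) (- qim q) (- qjm q) (- qkm q).
Definition quat_mul p q :=
  let: Quat a b c d := p in
  let: Quat a' b' c' d' := q in
  Quat (a * a' - b * b' - c * c' - d * d')
       (a * b' + b * a' + c * d' - d * c')
       (a * c' - b * d' + c * a' + d * b')
       (a * d' + b * c' - c * b' + d * a').

Fact quat_addA : associative quat_add.
Proof. by case=> ? ? ? ? [? ? ? ?] [? ? ? ?]; rewrite /quat_add/= !addrA. Qed.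
Fact quat_addC : commutative quat_add.
Proof.
by case=> ? ? ? ? [? ? ? ?]; rewrite /quat_add/=; congr Quat; rewrite addrC.
Qed.
Fact quat_add0 : left_id (Quat 0 0 0 0) quat_add.
Proof. by case=> ? ? ? ?; rewrite /quat_add/= !add0r. Qed.
Fact quat_addN : left_inverse (Quat 0 0 0 0) quat_opp quat_add.
Proof. by case=> ? ? ? ?; rewrite /quat_add/= !addNr. Qed.

HB.instance Definition _ :=
  GRing.isZmodule.Build H quat_addA quat_addC quat_add0 quat_addN.

Fact quat_mulA : associative quat_mul.
Proof. by case=> ? ? ? ? [? ? ? ?] [? ? ? ?] /=; congr Quat; ring. Qed.
Fact quat_mul1l : left_id (Quat 1 0 0 0) quat_mul.
Proof. by case=> ? ? ? ? /=; congr Quat; ring. Qed.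
Fact quat_mul1r : right_id (Quat 1 0 0 0) quat_mul.
Proof. by case=> ? ? ? ? /=; congr Quat; ring. Qed.
Fact quat_mulDl : left_distributive quat_mul +%R.
Proof. by case=> ? ? ? ? [? ? ? ?] [? ? ? ?] /=; congr Quat; rewrite /=; ring. Qed.
Fact quat_mulDr : right_distributive quat_mul +%R.
Proof. by case=> ? ? ? ? [? ? ? ?] [? ? ? ?] /=; congr Quat; rewrite /=; ring. Qed.
Fact quat_oner_neq0 : Quat 1 0 0 0 != 0 :> H.
Proof. by apply/eqP => -[/eqP]; rewrite oner_eq0. Qed.

HB.instance Definition _ :=
  GRing.Zmodule_isNzRing.Build H quat_mulA quat_mul1l quat_mul1r
    quat_mulDl quat_mulDr quat_oner_neq0.
End QuaternionRing.

Section QQPFT.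
Variable R : realType.
Local Notation H := (quaternion R).
Local Notation C := R[i].

Definition qnorm (q : H) : R :=
  Num.sqrt (qre q ^+ 2 + qim q ^+ 2 + qjm q ^+ 2 + qkm q ^+ 2).

(* The complex planes R + R i and R + R j inside the quaternions. *)
Definition iplane (z : C) : H := Quat (complex.Re z) (complex.Im z) 0 0.
Definition jplane (z : C) : H := Quat (complex.Re z) 0 (complex.Im z) 0.

Definition expi (t : R) : C := (cos t +i* sin t)%C.

Record qparam := QParam { pa : R; pb : R; pc : R; pd : R; pe : R }.

(* [sqrtc] is the principal square root (nonnegative real part); [sqrtC] is not,
   as it takes the root with nonnegative imaginary part. *)
Definition qp_kernel (mu : qparam) (x w : R) : C :=
  sqrtc (0 +i* (pb mu / (2 * pi)))%C *
  expi (- (pa mu * x ^+ 2 + pb mu * x * w + pc mu * w ^+ 2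
           + pd mu * x + pe mu * w)).

Local Notation Rm := (measurableTypeR R).

Definition lebesgue2 : set (Rm * Rm) -> \bar R :=
  (@lebesgue_measure R \x @lebesgue_measure R)%E.

Definition qintegral (g : R * R -> H) : H :=
  Quat (Rintegral lebesgue2 setT (@qre R \o g))
       (Rintegral lebesgue2 setT (@qim R \o g))
       (Rintegral lebesgue2 setT (@qjm R \o g))
       (Rintegral lebesgue2 setT (@qkm R \o g)).

Definition qmeasurable (f : R * R -> H) : Prop :=
  [/\ measurable_fun [set: Rm * Rm] (@qre R \o f),
      measurable_fun [set: Rm * Rm] (@qim R \o f),
      measurable_fun [set: Rm * Rm] (@qjm R \o f) &
      measurable_fun [set: Rm * Rm] (@qkm R \o f)].

Definition qLnorm (p : \bar R) (f : R * R -> H) : \bar R :=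
  'N[lebesgue2]_p [EFin \o @qnorm \o f].

(* Functions rather than classes of functions modulo equality a.e. *)
Definition qLp (p : \bar R) : set (R * R -> H) :=
  [set f | qmeasurable f /\ (qLnorm p f < +oo)%E].

Definition QQPFT1 (mu1 mu2 : qparam) (f : R * R -> H) (w : R * R) : H :=
  qintegral (fun x => iplane (qp_kernel mu1 x.1 w.1) * f x
                      * jplane (qp_kernel mu2 x.2 w.2)).

(* [T] is the continuous extension to L^2 of the restriction of the integral
   transform to the intersection of L^1 and L^2. As L^2 consists of functions,
   [T] is determined up to equality a.e. of its values; continuity makes it
   compatible with equality a.e. of its arguments. *)
Definition is_QQPFT2 (mu1 mu2 : qparam)
    (T : (R * R -> H) -> (R * R -> H)) : Prop :=
  [/\ forall f, qLp 2%:E f -> qLp 2%:E (T f),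
      forall f, qLp 1%:E f -> qLp 2%:E f ->
        {ae lebesgue2, forall w, T f w = QQPFT1 mu1 mu2 f w} &
      forall f, qLp 2%:E f -> forall e : R, 0 < e ->
        exists2 d : R, 0 < d &
          forall g, qLp 2%:E g -> (qLnorm 2%:E (fun x => (g x - f x)%R) < d%:E)%E ->
            (qLnorm 2%:E (fun w => (T g w - T f w)%R) < e%:E)%E].

End QQPFT.

(* Main.v *)
(* For f in L^1 the formula is the change of variable x -> x + k in the
   integral: completing the phase gives
     K(x + k, w) = e^{-i theta} K(x, w + 2 a k / b),
   and the unimodular factors leave the integral on the left and on the right.
   In L^2, both f |-> Q (f (. - k)) and f |-> the right-hand side are
   continuous, because translations and multiplication by unit quaternions preserve the L^2
   norm; they agree almost everywhere on the intersection of L^1 and L^2, which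
   is dense (truncate f to large squares). *)

From HB Require Import structures.
Require Import Defs.
From mathcomp Require Import all_boot all_order all_algebra.
From mathcomp Require Import all_classical all_reals all_analysis.
From mathcomp Require Import measurable_realfun ring lra.

Set Implicit Arguments.
Unset Strict Implicit.
Unset Printing Implicit Defensive.
Import Order.TTheory GRing.Theory Num.Theory.
Import numFieldNormedType.Exports.

Local Open Scope classical_set_scope.
Local Open Scope ring_scope.

(** * Quaternion norm identities and the embedded complex planes *)

Section QuaternionAlgebra.
Variable R : realType.
Implicit Types (p q r : quaternion R) (z : R[i]).

(** Keeping the norm squared makes it a polynomial in the coordinates, so its algebra reduces to
    [ring] and [lra]. *)
Definition qnorm2 q : R := qre q ^+ 2 + qim q ^+ 2 + qjm q ^+ 2 + qkm q ^+ 2.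

Lemma qnorm2_ge0 q : 0 <= qnorm2 q.
Proof. by rewrite /qnorm2 !addr_ge0// sqr_ge0. Qed.

Lemma qnorm2_0 : qnorm2 (0 : quaternion R) = 0.
Proof. by rewrite /qnorm2 /= expr0n /= !addr0. Qed.

(** This is Euler's four-square identity. *)
Lemma qnorm2M p q : qnorm2 (p * q) = qnorm2 p * qnorm2 q.
Proof. by case: p q => ? ? ? ? [? ? ? ?]; rewrite /qnorm2 /=; ring. Qed.

Lemma qnorm2B p q : qnorm2 (p - q) = qnorm2 (q - p).
Proof. by case: p q => ? ? ? ? [? ? ? ?]; rewrite /qnorm2 /=; ring. Qed.

(** By the parallelogram law the two sides differ by [qnorm2 (p - q)]. *)
Lemma qnorm2D_le p q : qnorm2 (p + q) <= 2 * qnorm2 p + 2 * qnorm2 q.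
Proof.
have := qnorm2_ge0 (p - q).
case: p q => ? ? ? ? [? ? ? ?]; rewrite /qnorm2 /=; lra.
Qed.

Lemma qnorm2_eq0 q : qnorm2 q = 0 -> q = 0.
Proof.
case: q => a b c d; rewrite /qnorm2 /= => /eqP.
rewrite !paddr_eq0 ?addr_ge0 ?sqr_ge0// !sqrf_eq0.
by move=> /andP[/andP[/andP[/eqP-> /eqP->] /eqP->] /eqP->].
Qed.

Lemma qnorm_ge0 q : 0 <= qnorm q.
Proof. exact: sqrtr_ge0. Qed.

Lemma sqr_qnorm q : qnorm q ^+ 2 = qnorm2 q.
Proof. by rewrite sqr_sqrtr// qnorm2_ge0. Qed.

(** From t <= 1 + t^2. On a set of finite measure this bounds the L^1 norm through the L^2 norm. *)
Lemma qnorm_le q : qnorm q <= 1 + qnorm2 q.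
Proof. by rewrite -sqr_qnorm; have := qnorm_ge0 q; nra. Qed.

Lemma normr_qcomp_le q : [/\ `|qre q| <= qnorm q, `|qim q| <= qnorm q,
  `|qjm q| <= qnorm q & `|qkm q| <= qnorm q].
Proof.
have sq (x : R) : x ^+ 2 <= qnorm2 q -> `|x| <= qnorm q.
  by move=> xq; rewrite -sqrtr_sqr ler_wsqrtr.
have [? ? ? ?] : [/\ 0 <= qre q ^+ 2, 0 <= qim q ^+ 2, 0 <= qjm q ^+ 2 &
  0 <= qkm q ^+ 2] by split; exact: sqr_ge0.
by split; apply: sq; rewrite /qnorm2; lra.
Qed.

Lemma iplaneM z z' : iplane (z * z') = iplane z * iplane z'.
Proof. by case: z z' => ? ? [? ?]; rewrite /iplane /=; congr Quat; ring. Qed.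

Lemma jplaneM z z' : jplane (z * z') = jplane z * jplane z'.
Proof. by case: z z' => ? ? [? ?]; rewrite /jplane /=; congr Quat; ring. Qed.

Lemma expiD (s t : R) : expi (s + t) = expi s * expi t.
Proof.
by apply/eqP; rewrite eq_complex /= cosD sinD [sin s * _ + _]addrC !eqxx.
Qed.

Lemma qnorm2_iplane_expi (t : R) : qnorm2 (iplane (expi t)) = 1.
Proof. by rewrite /qnorm2 /= expr0n /= !addr0 cos2Dsin2. Qed.

Lemma qnorm2_jplane_expi (t : R) : qnorm2 (jplane (expi t)) = 1.
Proof. by rewrite /qnorm2 /= expr0n /= !addr0 cos2Dsin2. Qed.

End QuaternionAlgebra.

(** * Translation invariance of Lebesgue measure and integral on the plane *)

Section Translation.
Variable R : realType.
Local Notation leb := (@lebesgue_measure R).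
Local Notation Rm := (measurableTypeR R).
Local Notation leb2 := (@lebesgue_measure R \x @lebesgue_measure R)%E.
Implicit Types s : R * R.

Lemma measurable_translate1 (t : R) : measurable_fun [set: Rm]
  (fun x : Rm => x + t : Rm).
Proof. by apply: measurable_funD. Qed.

(** The pushforward of Lebesgue measure under the translation gives intervals their length, and a
    measure that does so is Lebesgue measure. *)
Lemma lebesgue_measure_translate (t : R) (A : set Rm) : measurable A ->
  leb [set x : Rm | A (x + t)] = leb A.
Proof.
move=> mA.
pose phi := fun x : Rm => x + t : Rm.
have mphi : measurable_fun [set: Rm] phi := measurable_translate1 t.
(* Bundling the translation as a measurable function equips its pushforward with the structure of a
   measure. *)
pose phim := HB.pack_for {mfun Rm >-> Rm} phi
  (isMeasurableFun.Build _ _ _ _ _ mphi).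
apply/esym.
apply: (@lebesgue_measure_unique R (pushforward leb phim)) => //= _ [[a b]] _ <-.
rewrite /pushforward /= (_ : phi @^-1` _ = [set` `]a - t, b - t]]).
  rewrite !lebesgue_measure_itv /= !lte_fin ltrD2r; case: ifPn => // _.
  by congr (_%:E); ring.
by apply/seteqP; split => x /=; rewrite !in_itv /= ltrBlDr lerBrDr.
Qed.

Lemma measurable_translate s :
  measurable_fun [set: Rm * Rm] (fun x : Rm * Rm => x + s : Rm * Rm).
Proof.
apply/measurable_fun_pairP; split.
  by apply: (@measurable_funD _ (Rm * Rm)%type R setT fst (cst s.1)).
by apply: (@measurable_funD _ (Rm * Rm)%type R setT snd (cst s.2)).
Qed.

(** Uniqueness of the product measure reduces the claim to rectangles, where the one-dimensional
    invariance applies to each side. *)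
Lemma lebesgue2_translate s (A : set (Rm * Rm)) : measurable A ->
  lebesgue2 [set x : Rm * Rm | A (x + s)] = lebesgue2 A.
Proof.
move=> mA.
pose phi := fun x : Rm * Rm => x + s : Rm * Rm.
have mphi : measurable_fun [set: Rm * Rm] phi := measurable_translate s.
pose phim := HB.pack_for {mfun (Rm * Rm)%type >-> (Rm * Rm)%type} phi
  (isMeasurableFun.Build _ _ _ _ _ mphi).
apply/esym.
apply: (@product_measure_unique _ _ Rm Rm R leb leb (pushforward leb2 phim)) => //.
move=> X Y mX mY.
transitivity (leb2 ([set x | X (x + s.1)] `*` [set x | Y (x + s.2)])) => //.
rewrite product_measure1E.
- by congr (_ * _)%E; exact: lebesgue_measure_translate.
- by rewrite -[X in measurable X]setTI; exact: measurable_translate1.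
- by rewrite -[X in measurable X]setTI; exact: measurable_translate1.
Qed.

Lemma negligible_translate s (A : set (Rm * Rm)) :
  (@lebesgue2 R).-negligible A -> (@lebesgue2 R).-negligible [set x | A (x + s)].
Proof.
move=> [N [mN N0 AN]]; exists [set x | N (x + s)]; split.
- by rewrite -[X in measurable X]setTI; exact: measurable_translate.
- by rewrite lebesgue2_translate.
- by move=> x /=; exact: AN.
Qed.

Lemma ge0_integral_translate s (f : Rm * Rm -> \bar R) :
  measurable_fun setT f -> (forall x, 0 <= f x)%E ->
  (\int[leb2]_x f (x + s)%R = \int[leb2]_x f x)%E.
Proof.
move=> mf f0.
pose phi := fun x : Rm * Rm => x + s : Rm * Rm.
have mphi : measurable_fun [set: Rm * Rm] phi := measurable_translate s.
pose phim := HB.pack_for {mfun (Rm * Rm)%type >-> (Rm * Rm)%type} phi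
  (isMeasurableFun.Build _ _ _ _ _ mphi).
transitivity (\int[pushforward leb2 phim]_x f x)%E.
  by rewrite ge0_integral_pushforward.
by apply: eq_measure_integral => A mA _; exact: lebesgue2_translate.
Qed.

(** The nonnegative case applies to the positive and negative parts; both integrals are then the
    same difference, even when it is infinite. *)
Lemma integral_translate s (f : Rm * Rm -> \bar R) : measurable_fun setT f ->
  (\int[leb2]_x f (x + s)%R = \int[leb2]_x f x)%E.
Proof.
move=> mf; rewrite integralE [RHS]integralE; congr (_ - _)%E.
- rewrite -(@ge0_integral_translate s f^\+%E) //; last exact: measurable_funepos.
  by apply: eq_integral => x _; rewrite !funeposE.
- rewrite -(@ge0_integral_translate s f^\-%E) //; last exact: measurable_funeneg.
  by apply: eq_integral => x _; rewrite !funenegE.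
Qed.

End Translation.

(** * Measurability of quaternion-valued functions and the squared L^2 norm *)

Section QuaternionFunctions.
Variable R : realType.
Local Notation Rm := (measurableTypeR R).
Local Notation H := (quaternion R).
Local Notation leb2 := (@lebesgue_measure R \x @lebesgue_measure R)%E.
Implicit Types f g : R * R -> H.

Lemma qmeasurableD f g : qmeasurable f -> qmeasurable g ->
  qmeasurable (fun x => f x + g x).
Proof. by move=> [? ? ? ?] [? ? ? ?]; split; exact: measurable_funD. Qed.

Lemma qmeasurableN f : qmeasurable f -> qmeasurable (fun x => - f x).
Proof. by move=> [? ? ? ?]; split; exact: measurable_funN. Qed.

Lemma qmeasurableB f g : qmeasurable f -> qmeasurable g ->
  qmeasurable (fun x => f x - g x).
Proof. by move=> ? ?; apply: qmeasurableD => //; exact: qmeasurableN. Qed.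

Lemma qmeasurableM f g : qmeasurable f -> qmeasurable g ->
  qmeasurable (fun x => f x * g x).
Proof.
(* The product is defined by matching on its factors, so its coordinates must be spelled out before
   measurability can be read off. *)
have reE p q : qre (p * q : H) =
  qre p * qre q - qim p * qim q - qjm p * qjm q - qkm p * qkm q.
  by case: p q => ? ? ? ? [].
have imE p q : qim (p * q : H) =
  qre p * qim q + qim p * qre q + qjm p * qkm q - qkm p * qjm q.
  by case: p q => ? ? ? ? [].
have jmE p q : qjm (p * q : H) =
  qre p * qjm q - qim p * qkm q + qjm p * qre q + qkm p * qim q.
  by case: p q => ? ? ? ? [].
have kmE p q : qkm (p * q : H) =
  qre p * qkm q + qim p * qjm q - qjm p * qim q + qkm p * qre q.
  by case: p q => ? ? ? ? [].
move=> [? ? ? ?] [? ? ? ?]; rewrite /qmeasurable /comp; split.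
- under eq_fun do rewrite reE.
  by do !apply: measurable_funB; exact: measurable_funM.
- under eq_fun do rewrite imE.
  apply: measurable_funB; last exact: measurable_funM.
  by do !apply: measurable_funD; exact: measurable_funM.
- under eq_fun do rewrite jmE.
  do 2 (apply: measurable_funD; last exact: measurable_funM).
  by apply: measurable_funB; exact: measurable_funM.
- under eq_fun do rewrite kmE.
  apply: measurable_funD; last exact: measurable_funM.
  apply: measurable_funB; last exact: measurable_funM.
  by apply: measurable_funD; exact: measurable_funM.
Qed.

Lemma qmeasurable_translate f (s : R * R) : qmeasurable f ->
  qmeasurable (fun x => f (x + s)).
Proof.
move=> [? ? ? ?]; have ms := measurable_translate s.
by split; [exact: (measurableT_comp (f := @qre R \o f))
  | exact: (measurableT_comp (f := @qim R \o f))
  | exact: (measurableT_comp (f := @qjm R \o f))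
  | exact: (measurableT_comp (f := @qkm R \o f))].
Qed.

Lemma qmeasurable_cst (q : H) : qmeasurable (cst q).
Proof. by split; exact: measurable_cst. Qed.

Lemma measurable_qnorm2 f : qmeasurable f ->
  measurable_fun [set: Rm * Rm] (@qnorm2 R \o f).
Proof.
by move=> [? ? ? ?]; do !apply: measurable_funD; exact: measurable_funX.
Qed.

Lemma measurable_qnorm2B f g : qmeasurable f -> qmeasurable g ->
  measurable_fun [set: Rm * Rm] (fun x => (qnorm2 (f x - g x))%:E).
Proof.
move=> mf mg; apply/measurable_EFinP.
exact: (measurable_qnorm2 (qmeasurableB mf mg)).
Qed.

Lemma measurable_qnorm f : qmeasurable f ->
  measurable_fun [set: Rm * Rm] (@qnorm R \o f).
Proof.
move=> mf; apply: (measurableT_comp (f := @Num.sqrt R)).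
  2: exact: measurable_qnorm2.
by apply: continuous_measurable_fun; exact: sqrt_continuous.
Qed.

Lemma measurable_expi (h : R * R -> R) : measurable_fun [set: Rm * Rm] h ->
  qmeasurable (fun x => iplane (expi (h x))) /\
  qmeasurable (fun x => jplane (expi (h x))).
Proof.
move=> mh.
have mcos : measurable_fun [set: Rm * Rm] (@cos R \o h).
  apply: measurableT_comp mh.
  by apply: continuous_measurable_fun; exact: continuous_cos.
have msin : measurable_fun [set: Rm * Rm] (@sin R \o h).
  apply: measurableT_comp mh.
  by apply: continuous_measurable_fun; exact: continuous_sin.
by split; split => //=; exact: measurable_cst.
Qed.

(** The square of the L^2 norm, in which all estimates below are made; no square root of an extended
    real then occurs. *)
Definition sqL2 f : \bar R := (\int[leb2]_x (qnorm2 (f x))%:E)%E.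

Lemma sqL2_ge0 f : (0 <= sqL2 f)%E.
Proof. by apply: integral_ge0 => x _; rewrite lee_fin qnorm2_ge0. Qed.

Lemma qLnorm2E f : qLnorm 2%:E f = (sqL2 f `^ 2^-1)%E.
Proof.
rewrite /qLnorm unlock /=; congr (_ `^ _)%E; apply: eq_integral => x _ /=.
by rewrite ger0_norm ?qnorm_ge0// powR_mulrn ?qnorm_ge0// sqr_qnorm.
Qed.

End QuaternionFunctions.

(** * Working with the L^2 and L^1 conditions through integrals *)

Section Norms.
Variable R : realType.
Local Notation Rm := (measurableTypeR R).
Local Notation H := (quaternion R).
Local Notation leb2 := (@lebesgue_measure R \x @lebesgue_measure R)%E.
Implicit Types f g : R * R -> H.

Lemma qLnorm2_lt f (e : R) : 0 < e ->
  (qLnorm 2%:E f < e%:E)%E = (sqL2 f < (e ^+ 2)%:E)%E.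
Proof.
move=> e0; rewrite qLnorm2E; have := sqL2_ge0 f.
(* Nonnegativity rules out the value -oo; at +oo both inequalities are false. *)
case: (sqL2 f) => [r| |]//; last by rewrite poweRyr ?invr_neq0// !ltNge !leey.
rewrite lee_fin poweR_EFin !lte_fin => r0.
rewrite powR12_sqrt// -[X in _ < X](ger0_norm (ltW e0)) -sqrtr_sqr.
by rewrite ltr_sqrt// exprn_gt0.
Qed.

Lemma qLnorm2_lty f : (qLnorm 2%:E f < +oo)%E = (sqL2 f < +oo)%E.
Proof.
rewrite qLnorm2E; apply/idP/idP; last exact: poweR_lty.
by apply: lty_poweRy; rewrite invr_neq0.
Qed.

Lemma sqL2_translate f (s : R * R) : qmeasurable f ->
  sqL2 (fun x => f (x + s)) = sqL2 f.
Proof.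
move=> mf; rewrite /sqL2.
rewrite -(integral_translate s (f := fun x => (qnorm2 (f x))%:E))//.
by apply/measurable_EFinP; exact: measurable_qnorm2.
Qed.

Lemma sqL2_ae_eq f g h : qmeasurable f -> qmeasurable g -> qmeasurable h ->
  {ae @lebesgue2 R, forall x, f x = g x} ->
  sqL2 (fun x => f x - h x) = sqL2 (fun x => g x - h x).
Proof.
move=> mf mg mh [N [mN N0 fgN]]; apply: ge0_ae_eq_integral => //.
- exact: measurable_qnorm2B.
- exact: measurable_qnorm2B.
- by move=> x _; rewrite lee_fin qnorm2_ge0.
- by move=> x _; rewrite lee_fin qnorm2_ge0.
- exists N; split => // x /=; apply: contra_notP => xN _.
  by move: (contra_notP (@fgN x) xN) => /= ->.
Qed.

(** Integrating [qnorm2D_le] replaces Minkowski's inequality. The factor 2 is harmless, since the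
    bounds it is applied to are arbitrarily small. *)
Lemma sqL2_triangle f g h : qmeasurable f -> qmeasurable g -> qmeasurable h ->
  (sqL2 (fun x => (f x - h x)%R) <=
   2%:E * sqL2 (fun x => (f x - g x)%R) + 2%:E * sqL2 (fun x => (g x - h x)%R))%E.
Proof.
move=> mf mg mh.
have mfg : measurable_fun [set: Rm * Rm] (fun x => (qnorm2 (f x - g x))%:E).
  exact: measurable_qnorm2B.
have mgh : measurable_fun [set: Rm * Rm] (fun x => (qnorm2 (g x - h x))%:E).
  exact: measurable_qnorm2B.
rewrite /sqL2 -!ge0_integralZl//; first last.
- by move=> x _; rewrite lee_fin qnorm2_ge0.
- by move=> x _; rewrite lee_fin qnorm2_ge0.
rewrite -ge0_integralD//; first last.
- exact: measurable_funeM.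
- by move=> x _; rewrite mule_ge0// lee_fin qnorm2_ge0.
- exact: measurable_funeM.
- by move=> x _; rewrite mule_ge0// lee_fin qnorm2_ge0.
apply: ge0_le_integral => //.
- by move=> x _; rewrite lee_fin qnorm2_ge0.
- exact: measurable_qnorm2B.
- by apply: emeasurable_funD; exact: measurable_funeM.
move=> x _; rewrite -!EFinM -EFinD lee_fin.
by rewrite -[f x - h x](subrKA (g x)) qnorm2D_le.
Qed.

Lemma sqL2_eq0_ae f g : qmeasurable f -> qmeasurable g ->
  sqL2 (fun x => f x - g x) = 0%E -> {ae @lebesgue2 R, forall x, f x = g x}.
Proof.
move=> mf mg fg0.
have mfg : measurable_fun [set: Rm * Rm] (fun x => (qnorm2 (f x - g x))%:E).
  exact: measurable_qnorm2B.
have [|N [mN N0 fgN]] := (ae_eq_integral_abs leb2 measurableT mfg).1.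
  rewrite -[RHS]fg0; apply: eq_integral => x _.
  by rewrite gee0_abs// lee_fin qnorm2_ge0.
exists N; split => // x /= fgx; apply: fgN => /= /(_ I) [] /qnorm2_eq0 /eqP.
by rewrite subr_eq0 => /eqP.
Qed.

(** This and [qLp2P] give access to domination arguments, which are stated for integrable
    functions. *)
Lemma qLp1P f : qmeasurable f ->
  qLp 1%:E f <-> leb2.-integrable setT (EFin \o (@qnorm R \o f)).
Proof.
move=> mf; have mn := measurable_qnorm mf.
rewrite /qLp /qLnorm /= Lnorm1; split => [[_ foo]|/integrableP[_ foo]].
  by apply/integrableP; split => //; exact/measurable_EFinP.
by split.
Qed.

Lemma qLp2P f : qmeasurable f ->
  qLp 2%:E f <-> leb2.-integrable setT (EFin \o (@qnorm2 R \o f)).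
Proof.
move=> mf; have mn := measurable_qnorm2 mf.
rewrite /qLp /= qLnorm2_lty; split => [[_ foo]|/integrableP[_ foo]].
  apply/integrableP; split; first exact/measurable_EFinP.
  under eq_integral do rewrite gee0_abs ?lee_fin ?qnorm2_ge0//.
  exact: foo.
split => //; move: foo.
by under eq_integral do rewrite gee0_abs ?lee_fin ?qnorm2_ge0//.
Qed.

Lemma qLp_translate f (s : R * R) :
  (qLp 1%:E f -> qLp 1%:E (fun x => f (x + s))) /\
  (qLp 2%:E f -> qLp 2%:E (fun x => f (x + s))).
Proof.
split=> -[mf foo]; have mfs := qmeasurable_translate s mf; split => //.
  move: foo; rewrite /qLnorm !Lnorm1.
  rewrite (integral_translate s (f := fun x => `|(qnorm (f x))%:E|%E))//.
  apply: measurableT_comp => //; apply/measurable_EFinP.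
  exact: measurable_qnorm.
by rewrite qLnorm2_lty sqL2_translate// -qLnorm2_lty.
Qed.

End Norms.

(** * Quaternion integrals and the translation formula for L^1 functions *)

Section Transform.
Variable R : realType.
Local Notation Rm := (measurableTypeR R).
Local Notation H := (quaternion R).
Local Notation leb2 := (@lebesgue_measure R \x @lebesgue_measure R)%E.
Implicit Types f g : R * R -> H.

Definition qintegrable g : Prop :=
  [/\ leb2.-integrable setT (EFin \o (@qre R \o g)),
      leb2.-integrable setT (EFin \o (@qim R \o g)),
      leb2.-integrable setT (EFin \o (@qjm R \o g)) &
      leb2.-integrable setT (EFin \o (@qkm R \o g))].

Lemma qintegrable_qnorm g : qmeasurable g ->
  leb2.-integrable setT (EFin \o (@qnorm R \o g)) -> qintegrable g.
Proof.
move=> [mr mi mj mk] ig.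
have dom (u : R * R -> R) : measurable_fun [set: Rm * Rm] u ->
    (forall x, `|u x| <= qnorm (g x)) -> leb2.-integrable setT (EFin \o u).
  move=> mu ug; apply: (le_integrable measurableT _ _ ig) => //.
    exact/measurable_EFinP.
  by move=> x _ /=; rewrite lee_fin (ger0_norm (qnorm_ge0 _)).
by split; apply: dom => // x; have [] := normr_qcomp_le (g x).
Qed.

(** Made for the integrand of the transform: at fixed frequency the kernels have constant modulus,
    so its squared norm is a constant times that of [f]. *)
Lemma qnormM_integrable f g (c : R) :
  leb2.-integrable setT (EFin \o (@qnorm R \o f)) -> qmeasurable g ->
  (forall x, qnorm2 (g x) = c * qnorm2 (f x)) -> qintegrable g.
Proof.
move=> intf mg gE; apply: qintegrable_qnorm => //.
apply: (eq_integrable measurableT _ _ _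
  (integrableZl measurableT (Num.sqrt c) intf)) => // x _ /=.
rewrite -EFinM; congr (_%:E).
have [c0|c0] := leP 0 c; first by rewrite -sqrtrM// -gE.
(* For negative [c] the square root is 0 by convention; the hypothesis then forces [g] to vanish, so
   the two sides still agree. *)
rewrite ler0_sqrtr ?ltW// mul0r.
apply/esym/eqP; rewrite sqrtr_eq0 -/(qnorm2 (g x)) gE.
by rewrite nmulr_rle0 ?qnorm2_ge0.
Qed.

(** Multiplication by a fixed quaternion is a real 4 by 4 matrix acting on coordinates; this handles
    one row of it. *)
Lemma Rintegral_lin4 (a b c d : R) (u v w z : R * R -> R) :
  leb2.-integrable setT (EFin \o u) -> leb2.-integrable setT (EFin \o v) ->
  leb2.-integrable setT (EFin \o w) -> leb2.-integrable setT (EFin \o z) ->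
  Rintegral leb2 setT (fun x => a * u x + b * v x + c * w x + d * z x) =
  a * Rintegral leb2 setT u + b * Rintegral leb2 setT v +
  c * Rintegral leb2 setT w + d * Rintegral leb2 setT z.
Proof.
have iZ (e : R) (t : R * R -> R) : leb2.-integrable setT (EFin \o t) ->
    leb2.-integrable setT (EFin \o (fun x => e * t x)).
  exact: integrableZl.
have iD (s t : R * R -> R) : leb2.-integrable setT (EFin \o s) ->
    leb2.-integrable setT (EFin \o t) ->
    leb2.-integrable setT (EFin \o (fun x => s x + t x)).
  by move=> is_ it; exact: (integrableD measurableT is_ it).
move=> iu iv iw iz.
rewrite (@RintegralD _ _ _ leb2 setT
  (fun x => a * u x + b * v x + c * w x))//; last 2 first.
- by do 2 (apply: (iD (fun x => _) (fun x => _)); last exact: iZ); exact: iZ.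
- exact: iZ.
rewrite (@RintegralD _ _ _ leb2 setT
  (fun x => a * u x + b * v x))//; last 2 first.
- by apply: (iD (fun x => _) (fun x => _)); exact: iZ.
- exact: iZ.
rewrite (@RintegralD _ _ _ leb2 setT (fun x => a * u x))//; try exact: iZ.
by rewrite !RintegralZl.
Qed.

(** The rows below are those of the matrix of left multiplication. Noncommutativity calls for
    another matrix on the right, in [qintegralZr]. *)
Lemma qintegralZl (p : H) g : qintegrable g ->
  qintegral (fun x => p * g x) = p * qintegral g.
Proof.
move=> [ir ii ij ik]; case: p => a b c d; rewrite {1}/qintegral.
transitivity (Quat
  (Rintegral leb2 setT (fun x =>
    a * qre (g x) + (- b) * qim (g x) + (- c) * qjm (g x) + (- d) * qkm (g x)))
  (Rintegral leb2 setT (fun x =>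
    a * qim (g x) + b * qre (g x) + c * qkm (g x) + (- d) * qjm (g x)))
  (Rintegral leb2 setT (fun x =>
    a * qjm (g x) + (- b) * qkm (g x) + c * qre (g x) + d * qim (g x)))
  (Rintegral leb2 setT (fun x =>
    a * qkm (g x) + b * qjm (g x) + (- c) * qim (g x) + d * qre (g x)))).
  by congr Quat; apply: eq_Rintegral => x _ /=; case: (g x) => ? ? ? ? /=; ring.
by rewrite !Rintegral_lin4//=; congr Quat; rewrite !mulNr.
Qed.

Lemma qintegralZr (p : H) g : qintegrable g ->
  qintegral (fun x => g x * p) = qintegral g * p.
Proof.
move=> [ir ii ij ik]; case: p => a b c d; rewrite {1}/qintegral.
transitivity (Quat
  (Rintegral leb2 setT (fun x =>
    a * qre (g x) + (- b) * qim (g x) + (- c) * qjm (g x) + (- d) * qkm (g x)))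
  (Rintegral leb2 setT (fun x =>
    b * qre (g x) + a * qim (g x) + d * qjm (g x) + (- c) * qkm (g x)))
  (Rintegral leb2 setT (fun x =>
    c * qre (g x) + (- d) * qim (g x) + a * qjm (g x) + b * qkm (g x)))
  (Rintegral leb2 setT (fun x =>
    d * qre (g x) + c * qim (g x) + (- b) * qjm (g x) + a * qkm (g x)))).
  by congr Quat; apply: eq_Rintegral => x _ /=; case: (g x) => ? ? ? ? /=; ring.
by rewrite !Rintegral_lin4//=; congr Quat; ring.
Qed.

Lemma qintegral_translate g (s : R * R) : qmeasurable g ->
  qintegral (fun x => g (x + s)) = qintegral g.
Proof.
have tr (u : R * R -> R) : measurable_fun [set: Rm * Rm] u ->
    Rintegral leb2 setT (fun x => u (x + s)) = Rintegral leb2 setT u.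
  move=> mu; congr fine.
  by rewrite -(integral_translate s (f := EFin \o u))//; exact/measurable_EFinP.
move=> [mr mi mj mk]; rewrite /qintegral.
congr Quat.
- exact: (tr (@qre R \o g)).
- exact: (tr (@qim R \o g)).
- exact: (tr (@qjm R \o g)).
- exact: (tr (@qkm R \o g)).
Qed.

Definition qp_phase (mu : qparam R) (x w : R) : R :=
  pa mu * x ^+ 2 + pb mu * x * w + pc mu * w ^+ 2 + pd mu * x + pe mu * w.

(** This is theta: the difference between [qp_phase] at (x + k, w) and at (x, w + 2 a k / b), which
    does not depend on x. *)
Definition qp_shift_phase (mu : qparam R) (k w : R) : R :=
  pa mu * k ^+ 2 + pd mu * k + pb mu * k * w
  - 4 * (pa mu ^+ 2 * pc mu / pb mu ^+ 2) * k ^+ 2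
  - 4 * (pa mu / pb mu) * pc mu * w * k
  - 2 * (pa mu / pb mu) * pe mu * k.

(** The frequency shift 2 a k / b is chosen so that b x (2 a k / b) absorbs the cross term 2 a k x
    of a (x + k)^2. *)
Lemma qp_kernel_shift (mu : qparam R) (x k w : R) : pb mu != 0 ->
  qp_kernel mu (x + k) w =
  expi (- qp_shift_phase mu k w) * qp_kernel mu x (w + 2 * pa mu * k / pb mu).
Proof.
move=> b0; rewrite /qp_kernel [RHS]mulrCA -expiD; congr (_ * expi _).
by rewrite /qp_shift_phase; field.
Qed.

Lemma measurable_qp_kernel (mu : qparam R) (h : R * R -> R) (w : R) :
  measurable_fun [set: Rm * Rm] h ->
  qmeasurable (fun x => iplane (qp_kernel mu (h x) w)) /\
  qmeasurable (fun x => jplane (qp_kernel mu (h x) w)).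
Proof.
move=> mh.
have [] : qmeasurable (fun x => iplane (expi (- qp_phase mu (h x) w))) /\
    qmeasurable (fun x => jplane (expi (- qp_phase mu (h x) w))).
  apply: measurable_expi; apply: measurable_funN.
  have mc c : measurable_fun [set: Rm * Rm] (fun x => c * h x).
    by apply: measurable_funM => //; exact: measurable_cst.
  do 2 apply: measurable_funD => //; apply: measurable_funD => //.
  - apply: measurable_funD.
      by apply: measurable_funM => //; exact: measurable_funX.
    by apply: measurable_funM => //; exact: measurable_funM.
move=> mi mj; split.
- under eq_fun do rewrite iplaneM.
  by apply: qmeasurableM mi; exact: qmeasurable_cst.
- under eq_fun do rewrite jplaneM.
  by apply: qmeasurableM mj; exact: qmeasurable_cst.
Qed.

(** The exponential is unimodular, so only the constant square-root factor contributes. *)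
Lemma qnorm2_qp_kernel (mu : qparam R) (w : R) : exists c, forall x,
  qnorm2 (iplane (qp_kernel mu x w)) = c /\ qnorm2 (jplane (qp_kernel mu x w)) = c.
Proof.
exists (qnorm2 (iplane (sqrtc (0 +i* (pb mu / (2 * pi)))%C))) => x.
rewrite iplaneM jplaneM !qnorm2M qnorm2_iplane_expi qnorm2_jplane_expi !mulr1.
by split => //; rewrite /qnorm2 /= expr0n /= !addr0.
Qed.

Lemma QQPFT1_translate (mu1 mu2 : qparam R) f (k w : R * R) :
  pb mu1 != 0 -> pb mu2 != 0 -> qLp 1%:E f ->
  QQPFT1 mu1 mu2 (fun x => f (x - k)) w =
    iplane (expi (- qp_shift_phase mu1 k.1 w.1)) *
    QQPFT1 mu1 mu2 f
      (w + (2 * pa mu1 * k.1 / pb mu1, 2 * pa mu2 * k.2 / pb mu2)) *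
    jplane (expi (- qp_shift_phase mu2 k.2 w.2)).
Proof.
move=> b1 b2 f1; have mf := f1.1; have /(qLp1P mf) intf := f1.
set w' := w + _.
pose G x :=
  iplane (qp_kernel mu1 x.1 w'.1) * f x * jplane (qp_kernel mu2 x.2 w'.2).
have mG : qmeasurable G.
  apply: qmeasurableM; last exact: (measurable_qp_kernel _ _ measurable_snd).2.
  apply: qmeasurableM => //; exact: (measurable_qp_kernel _ _ measurable_fst).1.
have [c1 c1E] := qnorm2_qp_kernel mu1 w'.1.
have [c2 c2E] := qnorm2_qp_kernel mu2 w'.2.
have G2 x : qnorm2 (G x) = c1 * c2 * qnorm2 (f x).
  by rewrite /G !qnorm2M (c1E _).1 (c2E _).2 mulrAC.
have iG : qintegrable G by exact: (qnormM_integrable intf mG G2).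
set p := iplane _; set q := jplane _.
have mpG : qmeasurable (fun x => p * G x).
  by apply: qmeasurableM => //; exact: qmeasurable_cst.
have ipG : qintegrable (fun x => p * G x).
  apply: (qnormM_integrable (c := qnorm2 p * (c1 * c2)) intf mpG) => x.
  by rewrite qnorm2M G2 mulrA.
rewrite -[QQPFT1 _ _ f w']/(qintegral G) -qintegralZl// -qintegralZr//.
(* After this change of variable the two integrands agree pointwise, and only the kernels remain to
   be compared. *)
rewrite -(qintegral_translate (- k)); last first.
  by apply: qmeasurableM => //; exact: qmeasurable_cst.
rewrite /QQPFT1; congr (qintegral _); apply/funext => x; rewrite /G /p /q.
have -> : qp_kernel mu1 x.1 w.1 =
    expi (- qp_shift_phase mu1 k.1 w.1) * qp_kernel mu1 (x - k).1 w'.1.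
  by rewrite -qp_kernel_shift// subrK.
(* Commutativity of the complex numbers puts the phase after the kernel, so that it ends up at the
   far right of the quaternion product. *)
have -> : qp_kernel mu2 x.2 w.2 =
    qp_kernel mu2 (x - k).2 w'.2 * expi (- qp_shift_phase mu2 k.2 w.2).
  by rewrite mulrC -qp_kernel_shift// subrK.
rewrite iplaneM jplaneM.
by rewrite !mulrA.
Qed.

End Transform.

(** * Density of the intersection of L^1 and L^2 in L^2 by truncation *)

Section Density.
Variable R : realType.
Local Notation Rm := (measurableTypeR R).
Local Notation H := (quaternion R).
Local Notation leb2 := (@lebesgue_measure R \x @lebesgue_measure R)%E.

Definition square (n : nat) : set (Rm * Rm) :=
  `[- n%:R, n%:R]%classic `*` `[- n%:R, n%:R]%classic.

Lemma measurable_square n : measurable (square n).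
Proof. by apply: measurableX; exact: measurable_itv. Qed.

Lemma lebesgue2_square_lty n : (leb2 (square n) < +oo)%E.
Proof.
rewrite product_measure1E; [|exact: measurable_itv..].
rewrite /= !lebesgue_measure_itv /=.
by case: ifPn => _; rewrite -?EFinM ?mule0 ltry.
Qed.

Lemma near_square (x : R * R) : \forall n \near \oo, square n x.
Proof.
near=> n; split; rewrite /= in_itv /= -ler_norml; near: n; exact: nbhs_infty_ger.
Unshelve. all: by end_near. Qed.

Definition truncate (f : R * R -> H) (n : nat) (x : R * R) : H :=
  if x \in square n then f x else 0.

Lemma qmeasurable_truncate f n : qmeasurable f -> qmeasurable (truncate f n).
Proof.
have tr (u : R * R -> R) : measurable_fun [set: Rm * Rm] u ->
    measurable_fun [set: Rm * Rm] (fun x => if x \in square n then u x else 0).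
  move=> mu; apply: ((measurable_restrictT u (measurable_square n)).1 _).
  exact: measurable_funS mu.
move=> [mr mi mj mk]; split.
- move: (tr _ mr); congr measurable_fun.
  by apply/funext => x; rewrite /truncate /=; case: ifP.
- move: (tr _ mi); congr measurable_fun.
  by apply/funext => x; rewrite /truncate /=; case: ifP.
- move: (tr _ mj); congr measurable_fun.
  by apply/funext => x; rewrite /truncate /=; case: ifP.
- move: (tr _ mk); congr measurable_fun.
  by apply/funext => x; rewrite /truncate /=; case: ifP.
Qed.

Lemma qLp_truncate (f : R * R -> H) n : qLp 2%:E f ->
  qLp 1%:E (truncate f n) /\ qLp 2%:E (truncate f n).
Proof.
move=> f2; have mf := f2.1; have /(qLp2P mf) if2 := f2.
have mt := qmeasurable_truncate n mf.
split.
- apply/(qLp1P mt).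
  have i1 : leb2.-integrable setT (fun x => (\1_(square n) x)%:E).
    apply/integrableP; split.
      by apply/measurable_EFinP; apply: measurable_indic; exact: measurable_square.
    under eq_integral do rewrite gee0_abs ?lee_fin//.
    rewrite integral_indic// ?setIT; first exact: lebesgue2_square_lty.
    exact: measurable_square.
  (* The dominating function is the indicator of the square plus |f|^2: inside the square this is
     [qnorm_le], outside the truncation is 0. *)
  apply: (le_integrable measurableT _ _ (integrableD measurableT i1 if2)).
    by apply/measurable_EFinP; exact: measurable_qnorm.
  move=> x _ /=; rewrite lee_fin ger0_norm ?qnorm_ge0//.
  rewrite ger0_norm; last by apply: addr_ge0 => //; exact: qnorm2_ge0.
  rewrite indicE /truncate; case: ifP => _ /=; first exact: qnorm_le.
  by rewrite add0r -[qnorm 0]/(Num.sqrt (qnorm2 0)) qnorm2_0 sqrtr0 qnorm2_ge0.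
- apply/(qLp2P mt); apply: (le_integrable measurableT _ _ if2).
    by apply/measurable_EFinP; exact: measurable_qnorm2.
  move=> x _ /=; rewrite lee_fin !ger0_norm ?qnorm2_ge0// /truncate.
  by case: ifP => //; rewrite qnorm2_0 qnorm2_ge0.
Qed.

Lemma qLp12_dense (f : R * R -> H) (e : R) : qLp 2%:E f -> 0 < e ->
  exists g, [/\ qLp 1%:E g, qLp 2%:E g &
    (sqL2 (fun x => (g x - f x)%R) < e%:E)%E].
Proof.
move=> f2 e0; have mf := f2.1; have /(qLp2P mf) if2 := f2.
have mt n := qmeasurable_truncate n mf.
pose u n x : \bar R := (qnorm2 (truncate f n x - f x))%:E.
(* Each point lies in all large squares, so the pointwise error is eventually exactly 0; dominated
   convergence with bound |f|^2 then applies. *)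
have u0 x : \forall n \near \oo, u n x = 0%E.
  near=> n; rewrite /u /truncate ifT ?subrr ?qnorm2_0//.
  by apply/mem_set; near: n; exact: near_square.
have cvg0 : (fun n => sqL2 (fun x => truncate f n x - f x)) @ \oo --> 0%E.
  have [||||_ _] := @dominated_convergence _ _ R leb2 setT measurableT u (cst 0%E)
      (EFin \o (@qnorm2 R \o f)) (fun n => measurable_qnorm2B (mt n) mf).
  - exact: measurable_cst.
  - by apply: nearW => x _; apply: cvg_near_cst; exact: u0.
  - exact: if2.
  - apply: nearW => x n _; rewrite /u /= ger0_norm ?qnorm2_ge0// lee_fin /truncate.
    case: ifP => _; first by rewrite subrr qnorm2_0 qnorm2_ge0.
    by rewrite qnorm2B subr0.
  by rewrite integral0.
have [n _ /(_ n (leqnn _)) ne] : \forall n \near \oo,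
    (sqL2 (fun x => (truncate f n x - f x)%R) < e%:E)%E.
  by apply: (cvg0 [set y | (y < e%:E)%E]); exact: open_ereal_lt'.
by exists (truncate f n); have [? ?] := qLp_truncate n f2; split.
Unshelve. all: by end_near. Qed.

End Density.

(** * Passage of the translation formula from the dense subspace to L^2 *)

Theorem theorem3p8 (R : realType) (mu1 mu2 : qparam R)
    (hb1 : pb mu1 != 0) (hb2 : pb mu2 != 0)
    (Q : (R * R -> quaternion R) -> (R * R -> quaternion R))
    (hQ : is_QQPFT2 mu1 mu2 Q)
    (f : R * R -> quaternion R) (hf : qLp 2%:E f) (k : R * R) :
  let theta (mu : qparam R) (ks ws : R) : R :=
    pa mu * ks ^+ 2 + pd mu * ks + pb mu * ks * ws
    - 4 * (pa mu ^+ 2 * pc mu / pb mu ^+ 2) * ks ^+ 2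
    - 4 * (pa mu / pb mu) * pc mu * ws * ks
    - 2 * (pa mu / pb mu) * pe mu * ks in
  {ae @lebesgue2 R, forall w : R * R,
    Q (fun x => f (x - k)) w =
      iplane (expi (- theta mu1 k.1 w.1))
      * Q f (w.1 + 2 * pa mu1 * k.1 / pb mu1, w.2 + 2 * pa mu2 * k.2 / pb mu2)
      * jplane (expi (- theta mu2 k.2 w.2))}.
Proof.
move=> theta; have [Q2 Q1 Qc] := hQ.
pose U (g : R * R -> quaternion R) x := g (x - k).
pose s : R * R := (2 * pa mu1 * k.1 / pb mu1, 2 * pa mu2 * k.2 / pb mu2).
pose p (w : R * R) := iplane (expi (- qp_shift_phase mu1 k.1 w.1)).
pose q (w : R * R) := jplane (expi (- qp_shift_phase mu2 k.2 w.2)).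
pose V (g : R * R -> quaternion R) w := p w * g (w + s) * q w.
(* The local [theta] is convertible to [qp_shift_phase], and the shifted argument to [w + s]. *)
suff : {ae @lebesgue2 R, forall w, Q (U f) w = V (Q f) w} by [].
have mphase (mu : qparam R) (c : R) (h : R * R -> R) :
    measurable_fun [set: measurableTypeR R * measurableTypeR R] h ->
    measurable_fun [set: measurableTypeR R * measurableTypeR R]
      (fun w => - qp_shift_phase mu c (h w)).
  move=> mh; apply: measurable_funN; rewrite /qp_shift_phase.
  have mc d : measurable_fun [set: measurableTypeR R * measurableTypeR R]
    (fun w => d * h w) by apply: measurable_funM => //; exact: measurable_cst.
  apply: measurable_funB; last exact: measurable_cst.
  apply: measurable_funB.
    apply: measurable_funB; last exact: measurable_cst.
    by apply: measurable_funD; [exact: measurable_cst|exact: mc].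
  by apply: measurable_funM; [exact: mc|exact: measurable_cst].
have mp : qmeasurable p by apply: (measurable_expi (mphase _ _ _ measurable_fst)).1.
have mq : qmeasurable q by apply: (measurable_expi (mphase _ _ _ measurable_snd)).2.
have mV g : qmeasurable g -> qmeasurable (V g).
  move=> mg; apply: qmeasurableM => //; apply: qmeasurableM => //.
  exact: qmeasurable_translate.
(* [V] preserves L^2 distances: the outer factors are unit quaternions and the rest is a
   translation. *)
have sqV g h : qmeasurable g -> qmeasurable h ->
    sqL2 (fun w => V g w - V h w) = sqL2 (fun w => g w - h w).
  move=> mg mh; rewrite -(sqL2_translate s (qmeasurableB mg mh)).
  apply: eq_integral => w _; congr (_%:E).
  rewrite /V -mulrBl -mulrBr !qnorm2M.
  by rewrite qnorm2_iplane_expi qnorm2_jplane_expi mul1r mulr1.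
have U1 g : qLp 1%:E g -> qLp 1%:E (U g) by exact: (qLp_translate g (- k)).1.
have U2 g : qLp 2%:E g -> qLp 2%:E (U g) by exact: (qLp_translate g (- k)).2.
have QUV g : qLp 1%:E g -> qLp 2%:E g ->
    {ae @lebesgue2 R, forall w, Q (U g) w = V (Q g) w}.
  move=> g1 g2; have h1 := Q1 _ (U1 _ g1) (U2 _ g2).
  (* [V] evaluates [Q g] at [w + s], so the exceptional null set of [g] has to be translated too. *)
  have /(negligible_translate s) h2 := Q1 _ g1 g2.
  apply: negligibleS (negligibleU h1 h2) => w /=.
  apply: contra_notP => /not_orP[/contrapT e1 /contrapT e2].
  by rewrite e1 /V e2 QQPFT1_translate.
have small e : 0 < e ->
    (sqL2 (fun w => (Q (U f) w - V (Q f) w)%R) <= (4 * e ^+ 2)%:E)%E.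
  move=> e0.
  have [d1 d10 Qd1] := Qc _ (U2 _ hf) _ e0.
  have [d2 d20 Qd2] := Qc _ hf _ e0.
  (* A single approximant [g] must serve the continuity of [Q] both at [U f] and at [f]; translation
     preserves its distance to [f]. *)
  pose d := Num.min d1 d2.
  have d0 : 0 < d by rewrite lt_min d10.
  have [g [g1 g2 gd]] := qLp12_dense hf (exprn_gt0 2 d0).
  have mQg := (Q2 _ g2).1; have mQf := (Q2 _ hf).1.
  have mQUg := (Q2 _ (U2 _ g2)).1; have mQUf := (Q2 _ (U2 _ hf)).1.
  have gdn : (qLnorm 2%:E (fun x => (g x - f x)%R) < d%:E)%E by rewrite qLnorm2_lt.
  have Ugdn : (qLnorm 2%:E (fun x => (U g x - U f x)%R) < d%:E)%E.
    rewrite qLnorm2_lt//.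
    rewrite (sqL2_translate (- k) (f := fun x => g x - f x))//.
    exact: qmeasurableB g2.1 hf.1.
  have := Qd1 _ (U2 _ g2) (lt_le_trans Ugdn _).
  rewrite lee_fin ge_min lexx qLnorm2_lt// => /(_ isT) E1.
  have := Qd2 _ g2 (lt_le_trans gdn _).
  rewrite lee_fin ge_min lexx orbT qLnorm2_lt// => /(_ isT) E2.
  (* The intermediate point is [Q (U g)], equal to [V (Q g)] almost everywhere. Each of the two
     distances is below e^2, hence 2 e^2 + 2 e^2 in total. *)
  apply: (le_trans (sqL2_triangle mQUf mQUg (mV _ mQf))).
  rewrite (sqL2_ae_eq mQUg (mV _ mQg) (mV _ mQf) (QUV _ g1 g2)) sqV//.
  rewrite (_ : sqL2 (fun x => Q (U f) x - Q (U g) x) =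
    sqL2 (fun x => Q (U g) x - Q (U f) x)); last first.
    by apply: eq_integral => w _; rewrite qnorm2B.
  rewrite (_ : 4 * e ^+ 2 = 2 * e ^+ 2 + 2 * e ^+ 2); last by ring.
  by rewrite [leRHS]EFinD !EFinM leeD// lee_wpmul2l// ltW.
apply: sqL2_eq0_ae; [exact: (Q2 _ (U2 _ hf)).1|exact/mV/(Q2 _ hf).1|].
apply/eqP; rewrite eq_le sqL2_ge0 andbT; apply/lee_addgt0Pr => e e0.
(* With this radius the bound 4 r^2 becomes exactly e. *)
rewrite add0e; apply: (le_trans (small (Num.sqrt (e / 4)) _)).
  by rewrite sqrtr_gt0 divr_gt0.
by rewrite lee_fin sqr_sqrtr; lra.
Qed.
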